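(* Let $\mathcal{A} \in \mathbb{C}^{n \times n \times p}$ and $\mathcal{B} \in \mathbb{C}^{n \times s \times p}$. (i) If $f \equiv q$, where $q$ is a polynomial with complex coefficients, then the tensor t-function $f(\mathcal{A}) * \mathcal{B}$ matches the polynomial notion in the t-product formalism, i.e., $$\mathtt{fold}\big(q(\mathtt{bcirc}(\mathcal{A})) \cdot \mathtt{unfold}(\mathcal{B})\big) = \mathtt{fold}\big(\mathtt{bcirc}(q(\mathcal{A})) \cdot \mathtt{unfold}(\mathcal{B})\big),$$ where $q(\mathcal{A})$ is the polynomial $q$ evaluated at $\mathcal{A}$ using t-product powers. (ii) Let $f$ be a scalar function defined on the spectrum of $\mathtt{bcirc}(\mathcal{A})$ and let $q$ be the Hermite interpolating polynomial of $f$ on the spectrum of $\mathtt{bcirc}(\mathcal{A})$, so that $f(\mathtt{bcirc}(\mathcal{A})) = q(\mathtt{bcirc}(\mathcal{A}))$. Then $f(\mathcal{A}) * \mathcal{B} = q(\mathcal{A}) * \mathcal{B}$. (iii) If $p = 1$ (so that $\mathcal{A}$ is an $n \times n$ matrix and $\mathcal{B}$ an $n \times s$ block vector) and $f$ is defined on the spectrum of $\mathcal{A}$, then the tensor t-function $f(\mathcal{A}) * \mathcal{B}$ equals the usual product $f(\mathcal{A})\mathcal{B}$ of the matrix function $f(\mathcal{A})$ with $\mathcal{B}$. (iv) If $f(z) = z^{-1}$ and $\mathtt{bcirc}(\mathcal{A})$ is invertible (i.e., $f$ is defined on its spectrum), then $f(\mathcal{A}) * \mathcal{A} = \mathcal{A}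 * f(\mathcal{A}) = \mathcal{I}_{n \times n \times p}$.
   Context: For a third-order tensor $\mathcal{A} \in \mathbb{C}^{m \times n \times p}$, let $A^{(k)} = \mathcal{A}(:,:,k) \in \mathbb{C}^{m\times n}$, $k = 1,\ldots,p$, denote its frontal slices. Define $\mathtt{unfold}(\mathcal{A}) \in \mathbb{C}^{mp \times n}$ as the block column with blocks $A^{(1)}, A^{(2)}, \ldots, A^{(p)}$ from top to bottom; $\mathtt{fold}$ is its inverse, $\mathtt{fold}(\mathtt{unfold}(\mathcal{A})) = \mathcal{A}$. Define $\mathtt{bcirc}(\mathcal{A}) \in \mathbb{C}^{mp \times np}$ as the block circulant matrix whose $(i,j)$ block ($1 \le i,j \le p$) is $A^{(k)}$ with $k \in \{1,\ldots,p\}$, $k \equiv i-j+1 \pmod p$ (so the first block column is $\mathtt{unfold}(\mathcal{A})$). The t-product of $\mathcal{A} \in \mathbb{C}^{m \times n \times p}$ and $\mathcal{B} \in \mathbb{C}^{n \times s \times p}$ is $\mathcal{A} * \mathcal{B} := \mathtt{fold}(\mathtt{bcirc}(\mathcal{A})\,\mathtt{unfold}(\mathcal{B})) \in \mathbb{C}^{m \times s \times p}$. The identity tensor $\mathcal{I}_{n\times n\times p}$ has first frontal slice $I_{n \times n}$ and all other frontal slices zero. For $\mathcal{A} \in \mathbb{C}^{n\times n\times p}$, powers are $\mathcal{A}^j := \mathcal{A} * \cdots * \mathcal{A}$ ($j$ times), $\mathcal{A}^0 := \mathcal{I}_{n \times n \times p}$, and for a polynomial $q(z) = \sum_j c_j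 z^j$, $q(\mathcal{A}) := \sum_j c_j \mathcal{A}^j$. Matrix functions: for a square matrix $M$ with distinct eigenvalues $\lambda_1,\ldots,\lambda_N$, where $n_j$ is the size of the largest Jordan block of $\lambda_j$, a scalar function $f$ is defined on the spectrum of $M$ if the values $f^{(k)}(\lambda_j)$ exist for $k = 0,\ldots,n_j - 1$, $j = 1,\ldots,N$. Then $f(M) := q(M)$, where $q$ is the unique (Hermite interpolating) polynomial of degree less than $\sum_j n_j$ with $q^{(k)}(\lambda_j) = f^{(k)}(\lambda_j)$ for all such $k, j$ (equivalently, $f(M)$ is given by the Jordan form definition). Tensor t-function: for $\mathcal{A} \in \mathbb{C}^{n\times n\times p}$, $\mathcal{B} \in \mathbb{C}^{n \times s\times p}$ and $f$ defined on the spectrum of $\mathtt{bcirc}(\mathcal{A})$, $f(\mathcal{A}) * \mathcal{B} := \mathtt{fold}\big(f(\mathtt{bcirc}(\mathcal{A})) \cdot \mathtt{unfold}(\mathcal{B})\big)$; and $f(\mathcal{A}) := \mathtt{fold}\big(f(\mathtt{bcirc}(\mathcal{A}))\,\mathbf{E}_1\big) \in \mathbb{C}^{n \times n \times p}$, where $\mathbf{E}_1 = \mathtt{unfold}(\mathcal{I}_{n\times n\times p}) \in \mathbb{C}^{np\times n}$. *)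

(* Defs.v *)
From HB Require Import structures.
From mathcomp Require Import all_boot all_order all_algebra.
From mathcomp Require Import all_classical all_reals topology normedtype derive.
From mathcomp Require Export complex.

Set Implicit Arguments.
Unset Strict Implicit.
Unset Printing Implicit Defensive.

Import Order.TTheory GRing.Theory Num.Theory.
Import numFieldNormedType.Exports.

Local Open Scope classical_set_scope.
Local Open Scope ring_scope.

Section Tensors.
Variable C : numClosedFieldType.

(* The frontal slices of a tensor are the matrices A k, indexed from 0. *)
Definition tensor (m n p : nat) := {ffun 'I_p -> 'M[C]_(m, n)}.

Section Unfold.
Variables m n p : nat.

Definition unfold (A : tensor m n p) : 'M[C]_(\sum_(k < p) m, n) :=
  \mxcol_(k < p) A k.

Definition fold (M : 'M[C]_(\sum_(k < p) m, n)) : tensor m n p :=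
  [ffun k => submxcol M k].

Lemma unfoldK : cancel unfold fold.
Proof. by move=> A; apply/ffunP => k; rewrite ffunE mxcolK. Qed.

Lemma foldK : cancel fold unfold.
Proof.
move=> M; rewrite -[RHS]submxcolK; apply: eq_mxcol => k.
by rewrite ffunE.
Qed.

End Unfold.

(* i - j is the subtraction of 'I_p.+1, i.e. modulo p.+1; the shift by one of
   the 1-based convention (k = i - j + 1) disappears since slices are indexed
   from 0. *)
Definition bcirc (m n p : nat) (A : tensor m n p.+1) :
    'M[C]_(\sum_(i < p.+1) m, \sum_(j < p.+1) n) :=
  \mxblock_(i < p.+1, j < p.+1) A (i - j).

Definition tprod (m n s p : nat) (A : tensor m n p.+1) (B : tensor n s p.+1) :
    tensor m s p.+1 :=
  fold (bcirc A *m unfold B).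

Definition tid (n p : nat) : tensor n n p.+1 :=
  [ffun k => if k == 0 then 1%:M else 0].

Definition tpow (n p : nat) (A : tensor n n p.+1) (j : nat) : tensor n n p.+1 :=
  iterop j (@tprod n n n p) A (tid n p).

Definition tpoly (n p : nat) (q : {poly C}) (A : tensor n n p.+1) :
    tensor n n p.+1 :=
  \sum_(j < size q) q`_j *: tpow A j.

(* Agrees with horner_mx, which is only available for 'M_N with N of the
   syntactic form N'.+1; the dimension of bcirc A is not of that form. *)
Definition mxhorner (N : nat) (q : {poly C}) (M : 'M[C]_N) : 'M[C]_N :=
  \sum_(j < size q) q`_j *: (M ^+ j).

Lemma mxhornerE (N : nat) (q : {poly C}) (M : 'M[C]_N.+1) :
  mxhorner q M = horner_mx M q.
Proof.
rewrite -[in RHS](coefK q) poly_def linear_sum; apply: eq_bigr => j _.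
by rewrite linearZ /= rmorphXn /= horner_mx_X.
Qed.

End Tensors.

Section MatrixFunctions.
Variable C : numClosedFieldType.

Definition jordan_block (lam : C) (k : nat) : 'M[C]_k :=
  \matrix_(i, j) (if i == j then lam else if i.+1 == j :> nat then 1 else 0).

(* A pair (lam, k) in s stands for a Jordan block of size k for lam. *)
Definition jordan_mx (s : seq (C * nat)) :
    'M[C]_(\sum_(i < size s) (tnth (in_tuple s) i).2) :=
  \mxdiag_(i < size s)
     jordan_block (tnth (in_tuple s) i).1 (tnth (in_tuple s) i).2.

(* P and Q are mutually inverse; they are formally rectangular because the
   dimension of jordan_mx s is only propositionally equal to N. *)
Definition is_jordan_form (N : nat) (M : 'M[C]_N) (s : seq (C * nat)) : Prop :=
  all (fun b => 0 < b.2)%N s /\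
  exists P Q, [/\ P *m Q = 1%:M, Q *m P = 1%:M & M = P *m jordan_mx s *m Q].

Definition jordan_form (N : nat) (M : 'M[C]_N) : seq (C * nat) :=
  xget [::] [set s | is_jordan_form M s].

Definition max_jordan_size (N : nat) (M : 'M[C]_N) (lam : C) : nat :=
  \max_(b <- jordan_form M | b.1 == lam) b.2.

Definition spectrum (N : nat) (M : 'M[C]_N) : seq C :=
  undup (sval (closed_field_poly_normal (char_poly M))).

Lemma spectrum_uniq (N : nat) (M : 'M[C]_N) : uniq (spectrum M).
Proof. exact: undup_uniq. Qed.

Lemma mem_spectrum (N : nat) (M : 'M[C]_N) (lam : C) :
  (lam \in spectrum M) = eigenvalue M lam.
Proof.
rewrite mem_undup eigenvalue_root_char.
case: closed_field_poly_normal => r /= ->.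
by rewrite (monicP (char_poly_monic M)) scale1r root_prod_XsubC.
Qed.

(* Scalar functions may be partial: f is considered on its domain D only, and
   its values outside D are irrelevant. Derivatives are complex derivatives;
   one of order k.+1 at z requires that of order k around z. *)
Fixpoint has_derivative (D : set C) (f : C -> C) (k : nat) (z : C) : Prop :=
  if k is k'.+1 then
    (\forall w \near z, has_derivative D f k' w) /\
    derivable (derive1n k' f) z 1
  else D z.

Definition defined_on_spectrum (D : set C) (f : C -> C)
    (N : nat) (M : 'M[C]_N) : Prop :=
  forall lam, lam \in spectrum M ->
  forall k, (k < max_jordan_size M lam)%N -> has_derivative D f k lam.

(* size q is the degree plus one (0 for q = 0). *)
Definition is_hermite_interpolant (f : C -> C) (N : nat) (M : 'M[C]_N)
    (q : {poly C}) : Prop :=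
  (size q <= \sum_(lam <- spectrum M) max_jordan_size M lam)%N /\
  forall lam, lam \in spectrum M ->
  forall k, (k < max_jordan_size M lam)%N ->
    (derivn k q).[lam] = derive1n k f lam.

Definition hermite_interpolant (f : C -> C) (N : nat) (M : 'M[C]_N) :
    {poly C} :=
  xget 0 [set q | is_hermite_interpolant f M q].

Definition matfun (f : C -> C) (N : nat) (M : 'M[C]_N) : 'M[C]_N :=
  mxhorner (hermite_interpolant f M) M.

Definition tfun_act (f : C -> C) (n s p : nat)
    (A : tensor C n n p.+1) (B : tensor C n s p.+1) : tensor C n s p.+1 :=
  fold (matfun f (bcirc A) *m unfold B).

Definition tfun (f : C -> C) (n p : nat) (A : tensor C n n p.+1) :
    tensor C n n p.+1 :=
  fold (matfun f (bcirc A) *m unfold (tid C n p)).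

End MatrixFunctions.

(* Main.v *)
Require Import Defs.
From mathcomp Require Import all_boot all_order all_algebra.
From mathcomp Require Import all_classical all_reals topology normedtype derive.
From mathcomp Require Import zify ring.
Import Order.TTheory GRing.Theory Num.Theory.
Import numFieldNormedType.Exports.
Local Open Scope classical_set_scope.
Local Open Scope complex_scope.
Local Open Scope ring_scope.

Set Implicit Arguments.
Unset Strict Implicit.
Unset Printing Implicit Defensive.

(** Two facts carry the theorem.

    The first concerns tensors: the block circulant matrix is an injective
    morphism from the t-product to the matrix product (bcirc_tprod, bcirc_tid,
    tprodA1), because the product of two block circulants convolves their
    slices over the cyclic group of indices.  Hence bcirc (q(A)) = q (bcirc A)
    for every polynomial q (bcirc_tpoly), and whatever is a polynomial in
    bcirc A can be transported back to tensors.

    The second concerns matrices: if a polynomial q has the same derivatives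
    as f at each eigenvalue of M, up to the size of the largest Jordan block,
    then f(M) = q(M) (matfun_interpolation).  Since f(M) is defined from a
    chosen Hermite interpolant, this needs two things.  An interpolant exists:
    reduce q modulo the product of the (X - lam)^m(lam), a polynomial of
    exactly the degree that bounds interpolants.  And two polynomials with
    the same data agree at M: their difference is divisible by
    (X - lam)^k for every Jordan block of size k, so it kills each block
    (mxhorner_jordan_eq0).  Both speak of the Jordan form of M, whose existence
    has to be proved (jordan_form_exists).

    The Jordan form is obtained by splitting off one chain at a time from a
    subspace V stable under M (exists_jordan_chains).  On V, M is annihilated
    by some g (X - lam)^(k+1), with g(lam) != 0, such that g (X - lam)^k does
    not annihilate it.  Choose a vector e of V and a covector phi such that
    e g(M) (M - lam)^k phi != 0.  The k+1 vectors e g(M) (M - lam)^i and the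
    k+1 covectors (M - lam)^(k-j) g(M) phi pair into a triangular matrix with
    nonzero diagonal, so V is the direct sum of the chain and of the common
    kernel in V of the covectors, and this kernel is stable under M.

    The statements on polynomials, on interpolants and on the inverse are then
    instances of matfun_interpolation; for p = 1, the matrices bcirc A and A 0
    differ only by a cast of their dimension.  For a polynomial the complex
    derivatives are the formal ones.  For the inverse, a Bezout relation gives
    q with X q = 1 modulo the product above; comparing derivatives of X q - 1
    at an eigenvalue yields the recurrence satisfied by the derivatives of 1/z,
    so q interpolates 1/z, and q(M) is the inverse of M. *)

(** * Polynomials of a square matrix *)

Section PolynomialOfMatrix.
Variable C : numClosedFieldType.
Implicit Types p q : {poly C}.

Lemma mxhornerD N p q (M : 'M[C]_N) :
  mxhorner (p + q) M = mxhorner p M + mxhorner q M.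
Proof.
case: N M => [|N] M; first by rewrite [LHS]flatmx0 [RHS]flatmx0.
by rewrite !mxhornerE rmorphD.
Qed.

Lemma mxhornerN N p (M : 'M[C]_N) : mxhorner (- p) M = - mxhorner p M.
Proof.
case: N M => [|N] M; first by rewrite [LHS]flatmx0 [RHS]flatmx0.
by rewrite !mxhornerE rmorphN.
Qed.

Lemma mxhornerM N p q (M : 'M[C]_N) :
  mxhorner (p * q) M = mxhorner p M *m mxhorner q M.
Proof.
case: N M => [|N] M; first by rewrite [LHS]flatmx0 [RHS]flatmx0.
by rewrite !mxhornerE rmorphM.
Qed.

Lemma mxhornerC N c (M : 'M[C]_N) : mxhorner c%:P M = c%:M.
Proof.
case: N M => [|N] M; first by rewrite [LHS]flatmx0 [RHS]flatmx0.
by rewrite mxhornerE horner_mx_C.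
Qed.

Lemma mxhornerX N (M : 'M[C]_N) : mxhorner 'X M = M.
Proof.
case: N M => [|N] M; first by rewrite [LHS]flatmx0 [RHS]flatmx0.
by rewrite mxhornerE horner_mx_X.
Qed.

Lemma mxhorner_XsubC N a (M : 'M[C]_N) : mxhorner ('X - a%:P) M = M - a%:M.
Proof. by rewrite mxhornerD mxhornerN mxhornerX mxhornerC. Qed.

Lemma mxhorner_char_poly N (M : 'M[C]_N) : mxhorner (char_poly M) M = 0.
Proof.
case: N M => [|N] M; first by rewrite [LHS]flatmx0.
by rewrite mxhornerE Cayley_Hamilton.
Qed.

Lemma mxhorner_dvdp N d p (M : 'M[C]_N) :
  d %| p -> mxhorner d M = 0 -> mxhorner p M = 0.
Proof. by move=> /dvdpP[r ->] d0; rewrite mxhornerM d0 mulmx0. Qed.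

(** With X a family of rows on which M acts by the small matrix J, the action
    of q(M) is q(J).  This single fact serves for stable subspaces, for Jordan
    chains and for the blocks of a Jordan form. *)
Lemma mxhorner_intertwine N K q (X : 'M[C]_(K, N)) (J : 'M_K) (M : 'M_N) :
  X *m M = J *m X -> X *m mxhorner q M = mxhorner q J *m X.
Proof.
move=> XM; rewrite mulmx_sumr mulmx_suml; apply: eq_bigr => j _.
rewrite -scalemxAr -scalemxAl; congr (_ *: _).
elim: (j : nat) => [|k IH]; first by rewrite !expr0 mulmx1 mul1mx.
by rewrite !exprSr mulmxA IH -mulmxA XM mulmxA.
Qed.

Lemma mxhorner_eigenvector N q (v : 'rV[C]_N) a (M : 'M_N) :
  v *m M = a *: v -> v *m mxhorner q M = q.[a] *: v.
Proof.
move=> vM; rewrite mulmx_sumr horner_coef scaler_suml; apply: eq_bigr => j _.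
rewrite -scalemxAr -scalerA; congr (_ *: _).
elim: (j : nat) => [|k IH]; first by rewrite !expr0 mulmx1 scale1r.
by rewrite !exprSr mulmxA IH -scalemxAl vM scalerA.
Qed.

Lemma stable_mxhorner N m q (V : 'M[C]_(m, N)) (M : 'M_N) :
  (V *m M <= V)%MS -> (V *m mxhorner q M <= V)%MS.
Proof.
move=> /submxP[D VM]; apply/submxP; exists (mxhorner q D).
exact: mxhorner_intertwine.
Qed.

End PolynomialOfMatrix.

(** * Existence of the Jordan form *)

Section JordanForm.
Variable C : numClosedFieldType.

Definition jordan_chain N (M : 'M[C]_N) lam k (v : 'rV_N) : 'M_(k, N) :=
  \matrix_(i < k) (v *m mxhorner (('X - lam%:P) ^+ i) M).

(** Multiplication by M = lam + (M - lam) sends each row of a chain to lam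
    times itself plus the next row; after the last one comes 0. *)
Lemma jordan_chainM N (M : 'M[C]_N) lam k v :
  v *m mxhorner (('X - lam%:P) ^+ k) M = 0 ->
  jordan_chain M lam k v *m M = jordan_block lam k *m jordan_chain M lam k v.
Proof.
move=> vk; apply/row_matrixP => i; rewrite !row_mul rowK.
have step j : v *m mxhorner (('X - lam%:P) ^+ j) M *m M =
    lam *: (v *m mxhorner (('X - lam%:P) ^+ j) M)
    + v *m mxhorner (('X - lam%:P) ^+ j.+1) M.
  rewrite -[X in _ *m X](subrK lam%:M) -mxhorner_XsubC mulmxDr.
  by rewrite mul_mx_scalar -mulmxA -mxhornerM -exprSr addrC.
rewrite step [RHS]mulmx_sum_row.
rewrite [RHS](eq_bigr (fun j : 'I_k =>
    ((j == i)%:R * lam) *: row j (jordan_chain M lam k v)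
    + (if i.+1 == j :> nat then row j (jordan_chain M lam k v) else 0)));
  last first.
  move=> j _; rewrite !mxE; have [->|_] := eqVneq i j.
    by rewrite gtn_eqF // mul1r addr0.
  by case: ifP => _; rewrite mul0r scale0r add0r ?scale1r ?scale0r.
rewrite big_split /=; congr (_ + _).
  rewrite (bigD1 i) //= eqxx mul1r rowK big1 ?addr0 // => j /negbTE ->.
  by rewrite mul0r scale0r.
have [ik|ki] := ltnP i.+1 k.
  rewrite (bigD1 (Ordinal ik)) //= eqxx rowK big1 ?addr0 // => j ji.
  by case: eqP => // ij; case/eqP: ji; apply: val_inj.
rewrite big1 => [|j _].
  have -> : i.+1 = k by apply/eqP; rewrite eqn_leq ki andbT.
  by rewrite vk.
by case: eqP => // ij; have := ltn_ord j; rewrite -ij ltnNge ki.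
Qed.

(** The characteristic polynomial annihilates V.  Remove its roots one by one
    until V is no longer annihilated; the last root removed is lam, and g is
    what remains once all factors X - lam are taken out. *)
Lemma exists_maximal_exponent N m (M : 'M[C]_N) (V : 'M_(m, N)) :
  V != 0 -> exists lam k g, [/\ ~~ root g lam,
    V *m mxhorner (g * ('X - lam%:P) ^+ k) M != 0 &
    V *m mxhorner (g * ('X - lam%:P) ^+ k.+1) M = 0].
Proof.
move=> V0; have [r r_char] := closed_field_poly_normal (char_poly M).
have {r_char} : V *m mxhorner (\prod_(a <- r) ('X - a%:P)) M = 0.
  rewrite -[\prod_(_ <- _) _]scale1r -(monicP (char_poly_monic M)) -r_char.
  by rewrite mxhorner_char_poly mulmx0.
elim: r => [|lam r IH].
  by rewrite big_nil -polyC1 mxhornerC mulmx1 => /eqP; rewrite (negbTE V0).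
rewrite big_cons; set f := \prod_(_ <- _) _ in IH *.
have [/IH //|fV fV0] := eqVneq (V *m mxhorner f M) 0.
have [k [g /implyP g_lam fE]] := multiplicity_XsubC f lam.
exists lam, k, g; rewrite -fE exprSr mulrA -fE mulrC; split=> //.
by apply: g_lam; apply: contraNneq fV => ->; rewrite -polyC0 mxhornerC
   raddf0 mulmx0.
Qed.

(** The chains are asked to span V and to have total length the rank of V;
    linear independence follows by counting, so that it never has to be carried
    through the induction. *)
Lemma exists_jordan_chains N (M : 'M[C]_N) m (V : 'M_(m, N)) :
  (V *m M <= V)%MS ->
  exists (s : seq (C * nat)) (v : nat -> 'rV[C]_N),
    [/\ all (fun b => 0 < b.2)%N s,
        forall i, (i < size s)%N ->
          v i *m mxhorner (('X - (nth (0, 0%N) s i).1%:P)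
                             ^+ (nth (0, 0%N) s i).2) M = 0,
        (V <= \sum_(i < size s) <<jordan_chain M (nth (0, 0%N) s i).1
                                    (nth (0, 0%N) s i).2 (v i)>>)%MS
      & (\sum_(b <- s) b.2 = \rank V)%N].
Proof.
have [r] := ubnP (\rank V); elim: r m V => // r IH m V; rewrite ltnS => rV VM.
have [V0|V0] := eqVneq V 0.
  by exists [::], (fun=> 0); rewrite V0 sub0mx big_nil mxrank0; split.
have [lam [k [g [g_lam Vk Vk1]]]] := exists_maximal_exponent M V0.
(* The vector e is the row i0 of V and phi is the coordinate form j0. *)
have /matrix0Pn[i0 [j0 e0]] := Vk.
pose h i := ('X - lam%:P) ^+ i.
pose v : 'rV_N := row i0 V *m mxhorner g M.
pose S := jordan_chain M lam k.+1 v.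
(* The order of the covectors is reversed to make S *m T triangular instead of
   antitriangular. *)
pose T : 'M_(N, k.+1) := \matrix_(i, j) mxhorner (g * h (k - j)%N) M i j0.
have wT n (w : 'M_(n, N)) i j :
    (w *m T) i j = (w *m mxhorner (g * h (k - j)%N) M) i j0.
  by rewrite !mxE; apply: eq_bigr => l _; rewrite !mxE.
have kill n (w : 'M_(n, N)) i :
    (w <= V)%MS -> (k < i)%N -> w *m mxhorner (g * h i) M = 0.
  move=> /submxP[D ->] ki; rewrite -(subnKC ki) /h exprD mulrA mxhornerM.
  by rewrite mulmxA -(mulmxA D) Vk1 mulmx0 mul0mx.
have vV q : (row i0 V *m mxhorner q M <= V)%MS.
  by rewrite -row_mul; apply: submx_trans (row_sub _ _) (stable_mxhorner _ VM).
have SV : (S <= V)%MS.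
  by apply/row_subP => i; rewrite rowK /v -mulmxA -mxhornerM.
have rowE1 n (X : 'M[C]_(n, N)) i : X i j0 = row i X 0 j0 by rewrite mxE.
have STE i j : (S *m T) i j =
    (row i0 V *m mxhorner g M *m mxhorner (g * h (i + (k - j))%N) M) 0 j0.
  by rewrite wT rowE1 row_mul rowK -mulmxA -mxhornerM mulrCA -exprD.
have STu : S *m T \in unitmx.
  rewrite -unitmx_tr unitmxE det_trig.
    rewrite unitfE; apply/prodf_neq0 => i _; rewrite mxE STE subnKC -1?ltnS //.
    rewrite -mulmxA -mxhornerM (mulrC g (g * h k)) mxhornerM mulmxA.
    (* A diagonal entry is a coordinate of w *m g(M), where w is an
       eigenvector for lam: it is g(lam) times the entry chosen nonzero. *)
    set w := _ *m mxhorner (g * h k) M; have wM : w *m M = lam *: w.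
      apply/eqP; rewrite -subr_eq0 -mul_mx_scalar -mulmxBr -mxhorner_XsubC.
      rewrite /w -mulmxA -mxhornerM -mulrA /h -exprSr -/(h k.+1).
      by rewrite kill ?row_sub.
    by rewrite (mxhorner_eigenvector _ wM) mxE mulf_neq0 // /w -row_mul mxE.
  apply/is_trig_mxP => j i ji; rewrite mxE STE kill ?vV ?mxE //.
  by have := ltn_ord i; lia.
pose W := (V :&: kermx T)%MS.
have WV : (W <= V)%MS by apply: capmxSl.
have rankW : (\rank V = k.+1 + \rank W)%N.
  rewrite -(mxrank_mul_ker V T); congr (_ + _)%N; apply/eqP; rewrite eqn_leq.
  rewrite rank_leq_col -{1}(mxrank_unit STu); apply: mxrankS; exact: submxMr.
have WM : (W *m M <= W)%MS.
  rewrite sub_capmx (submx_trans (submxMr _ WV) VM) /=; apply/sub_kermxP.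
  (* Powers of M - lam beyond k contribute nothing, hence W is killed by the
     covectors for all exponents i, a condition visibly stable under M. *)
  have W0 i j : (W *m mxhorner (g * h i) M) j j0 = 0.
    have [ki|ik] := ltnP k i; first by rewrite kill // mxE.
    have WT : W *m T = 0 by apply/sub_kermxP; apply: capmxSr.
    have := wT _ W j (inord (k - i)).
    by rewrite WT mxE inordK ?ltnS ?leq_subr // subKn.
  apply/matrixP => i j; rewrite wT -mulmxA -{1}(mxhornerX M) -mxhornerM.
  rewrite mulrCA -[X in X * h _](subrK lam%:P) mulrDl -exprS mulrDr mxhornerD.
  rewrite mulmxDr mxE W0 mulrCA mxhornerM mxhornerC mul_scalar_mx -scalemxAr.
  by rewrite mxE W0 mulr0 addr0 mxE.
have [|s [v' [s_pos chain_v' Wspan s_sum]]] := IH _ W _ WM.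
  by move: rV; rewrite rankW; lia.
exists ((lam, k.+1) :: s), (fun i => if i is i'.+1 then v' i' else v).
split=> //=.
- case=> [_|i] /=; last by exact: chain_v'.
  by rewrite /v -mulmxA -mxhornerM kill ?row_sub.
- rewrite big_ord_recl /=.
  (* D is the projection of V onto the chain along W. *)
  pose D := V *m T *m invmx (S *m T) *m S.
  rewrite -[V in (V <= _)%MS](subrK D) addrC; apply: addmx_sub_adds.
    by rewrite genmxE; apply: submxMl.
  apply: submx_trans Wspan.
  rewrite sub_capmx addmx_sub ?eqmx_opp //=; last first.
    exact: submx_trans (submxMl _ _) SV.
  by apply/sub_kermxP; rewrite mulmxBl -!mulmxA mulVmx // mulmx1 subrr.
- by rewrite big_cons s_sum rankW.
Qed.

Lemma jordan_form_exists N (M : 'M[C]_N) : exists s, is_jordan_form M s.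
Proof.
have [|s [v [s_pos chain_v span_v s_sum]]] := @exists_jordan_chains N M N 1%:M.
  exact: submx1.
pose b (i : 'I_(size s)) := tnth (in_tuple s) i.
pose Q := \mxcol_i jordan_chain M (b i).1 (b i).2 (v i).
have bE i : b i = nth (0, 0%N) s i by rewrite /b (tnth_nth (0, 0%N)).
have fullQ : row_full Q.
  rewrite -sub1mx (submx_trans span_v) //; apply/sumsmx_subP => i _.
  rewrite genmxE -bE.
  have <- : submxcol Q i = jordan_chain M (b i).1 (b i).2 (v i).
    exact: mxcolK.
  exact: rowsub_sub.
have freeQ : row_free Q.
  rewrite /row_free (eqP fullQ) -[X in X == _](mxrank1 C) -s_sum.
  by rewrite -[X in _ == X](big_tnth _ _ s xpredT (fun b => b.2)).
have [P PQ] := row_fullP fullQ; have [P' QP'] := row_freeP freeQ.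
have QP : Q *m P = 1%:M.
  have -> : P = P' by rewrite -[P]mulmx1 -QP' mulmxA PQ mul1mx.
  exact: QP'.
exists s; split=> //; exists P, Q; split=> //.
have QM : Q *m M = jordan_mx s *m Q.
  rewrite mul_mxdiag_mxcol mxcol_mul; apply: eq_mxcol => i.
  by rewrite jordan_chainM // bE; apply: chain_v.
by rewrite -mulmxA -QM mulmxA PQ mul1mx.
Qed.

Lemma jordan_formP N (M : 'M[C]_N) : is_jordan_form M (jordan_form M).
Proof. exact: (xgetPex [::] (jordan_form_exists M)). Qed.

(** A Jordan form seen as a basis of rows, grouped in chains on which M acts
    by the Jordan blocks.  The sizes k i are kept abstract, so that rewriting
    with an element of s leaves the dimension of Q untouched. *)
Lemma jordan_form_rows N (M : 'M[C]_N) s : is_jordan_form M s ->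
  exists (k : 'I_(size s) -> nat) (Q : 'M_(\sum_i k i, N)),
    [/\ row_free Q, row_full Q, forall i, k i = (tnth (in_tuple s) i).2 &
     forall i, submxcol Q i *m M
       = jordan_block (tnth (in_tuple s) i).1 (k i) *m submxcol Q i].
Proof.
move=> [_ [P [Q [PQ QP ->]]]].
exists (fun i => (tnth (in_tuple s) i).2), Q; split=> //.
- by apply/row_freeP; exists P.
- by apply/row_fullP; exists P.
move=> i; rewrite submxcol_mul !mulmxA QP mul1mx -[in LHS](submxcolK Q).
by rewrite mul_mxdiag_mxcol mxcolK.
Qed.

Lemma jordan_block_nilpotent lam k :
  mxhorner (('X - lam%:P) ^+ k) (jordan_block lam k) = 0 :> 'M[C]_k.
Proof.
have powE j : mxhorner (('X - lam%:P) ^+ j) (jordan_block lam k)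
    = \matrix_(i, l) (i + j == l)%N%:R.
  elim: j => [|j IH].
    rewrite expr0 -polyC1 mxhornerC; apply/matrixP => i l.
    by rewrite !mxE addn0.
  rewrite exprSr mxhornerM IH mxhorner_XsubC; apply/matrixP => i l.
  rewrite !mxE.
  have [ij|ij] := ltnP (i + j) k; last first.
    rewrite big1 => [|l' _]; last first.
      rewrite mxE gtn_eqF ?mul0r //; exact: leq_trans (ltn_ord l') ij.
    by rewrite gtn_eqF // addnS ltnS ltnW // (leq_trans (ltn_ord l)).
  rewrite (bigD1 (Ordinal ij)) //= big1 ?addr0 => [|l' l'ij]; last first.
    rewrite mxE; case: eqP => [e|_]; last by rewrite mul0r.
    by case/eqP: l'ij; apply: val_inj.
  rewrite !mxE eqxx mul1r addnS; have [<-|_] := eqVneq (Ordinal ij) l.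
    by rewrite subrr gtn_eqF.
  by rewrite subr0; case: eqP.
rewrite powE; apply/matrixP => i l; rewrite !mxE gtn_eqF //.
by rewrite ltn_addl.
Qed.

Lemma mxhorner_jordan_eq0 N (M : 'M[C]_N) s q : is_jordan_form M s ->
  (forall b, b \in s -> ('X - b.1%:P) ^+ b.2 %| q) -> mxhorner q M = 0.
Proof.
move=> /jordan_form_rows[k [Q [_ /row_fullP[P PQ] kE QM]]] dv_q.
rewrite -[LHS]mul1mx -PQ -mulmxA -[X in P *m X]submxcolK.
rewrite (_ : \mxcol_i _ = 0) ?mulmx0 // -[RHS]mxcol0; apply: eq_mxcol => i.
rewrite -submxcol_mul (mxhorner_intertwine _ (QM i)).
have := dv_q _ (mem_tnth i (in_tuple s)); rewrite -kE => /mxhorner_dvdp.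
by move=> /(_ _ _ (jordan_block_nilpotent _ _)) ->; rewrite mul0mx.
Qed.

(** The last row of a chain is an eigenvector. *)
Lemma jordan_form_eigenvalue N (M : 'M[C]_N) s b : is_jordan_form M s ->
  b \in s -> eigenvalue M b.1.
Proof.
move=> sM /[dup] /(allP sM.1) b_pos /(tnthP (in_tuple s))[i bE].
have [k [Q [Q_free _ kE QM]]] := jordan_form_rows sM.
have ki : ((k i).-1 < k i)%N by rewrite prednK kE -bE.
pose l := Ordinal ki; pose w := row l (submxcol Q i).
apply/eigenvalueP; exists w.
  rewrite -row_mul QM row_mul /w [row l (submxcol _ _)]rowE scalemxAl -bE.
  congr (_ *m _); apply/rowP => j; rewrite !mxE eqxx /= eq_sym.
  case: eqP => [_|_]; first by rewrite mulr1.
  by rewrite prednK ?kE -?bE // mulr0; case: eqP => // ej;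
     have := ltn_ord j; rewrite -ej kE -bE ltnn.
have -> : w = row (tagnat.Rank i l) Q by apply/rowP => j; rewrite !mxE.
rewrite rowE mulmx_free_eq0 //; apply/eqP => /rowP/(_ (tagnat.Rank i l)).
by rewrite !mxE !eqxx => /eqP; rewrite oner_eq0.
Qed.

(** The product of the (X - lam)^k over the blocks annihilates M, so every
    eigenvalue is one of its roots. *)
Lemma spectrum_jordan_form N (M : 'M[C]_N) s lam : is_jordan_form M s ->
  lam \in spectrum M -> exists2 b, b \in s & b.1 = lam.
Proof.
move=> sM; rewrite mem_spectrum => /eigenvalueP[v vM v0].
pose q := \prod_(b <- s) ('X - b.1%:P) ^+ b.2.
have qM : mxhorner q M = 0.
  apply: (mxhorner_jordan_eq0 sM) => b bs.
  by rewrite /q (big_rem b) //= dvdp_mulr.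
have := mxhorner_eigenvector q vM; rewrite qM mulmx0 => /esym/eqP.
rewrite scaler_eq0 (negbTE v0) orbF /q horner_prod prodf_seq_eq0.
move=> /hasP[b bs /=]; rewrite horner_exp expf_eq0 hornerXsubC subr_eq0.
by move=> /andP[_ /eqP]; exists b.
Qed.

Lemma leq_max_jordan_size N (M : 'M[C]_N) b :
  b \in jordan_form M -> (b.2 <= max_jordan_size M b.1)%N.
Proof.
by move=> bM; rewrite /max_jordan_size (big_rem b) //= eqxx leq_maxl.
Qed.

Lemma max_jordan_size_gt0 N (M : 'M[C]_N) lam :
  lam \in spectrum M -> (0 < max_jordan_size M lam)%N.
Proof.
move=> /(spectrum_jordan_form (jordan_formP M))[b bM <-].
apply: leq_trans (leq_max_jordan_size bM).
by have [/allP/(_ _ bM)] := jordan_formP M.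
Qed.

End JordanForm.

(** * Hermite interpolation on the spectrum *)

Section HermiteInterpolation.
Variable C : numClosedFieldType.
Implicit Types p q : {poly C}.

Lemma derivn_XsubC_mul a q k :
  (('X - a%:P) * q)^`(k.+1) = ('X - a%:P) * q^`(k.+1) + q^`(k) *+ k.+1.
Proof.
have derivnMX : (q * 'X)^`(k.+1) = q^`(k) *+ k.+1 + q^`(k.+1) * 'X.
  by rewrite -(derivnMXaddC _ _ 0) polyC0 addr0.
rewrite !mulrBl !mul_polyC derivnB derivnZ !(mulrC 'X) derivnMX.
by rewrite [_ *+ _ + _]addrC addrAC.
Qed.

(** For q = (X - a) p, the derivative of order k+1 of q at a is k+1 times that
    of order k of p, and k+1 is invertible in characteristic 0: both sides
    lose one order when one factor is taken out. *)
Lemma dvdp_exp_XsubCP a m q :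
  reflect (forall k, (k < m)%N -> q^`(k).[a] = 0) (('X - a%:P) ^+ m %| q).
Proof.
have XmS k p : ((('X - a%:P) * p)^`(k.+1)).[a] = p^`(k).[a] *+ k.+1.
  by rewrite derivn_XsubC_mul hornerD hornerM hornerXsubC subrr mul0r add0r
             hornerMn.
apply: (iffP idP).
  move=> /dvdpP[r ->]; rewrite mulrC; elim: m => // m IH [_|k km].
    by rewrite derivn0 exprS -mulrA hornerM hornerXsubC subrr mul0r.
  by rewrite exprS -mulrA XmS IH ?mul0rn.
elim: m q => [|m IH] q q0; first by rewrite expr0 dvd1p.
have /factor_theorem[p qE] : root q a by apply/rootP; rewrite -(q0 0%N).
rewrite exprSr qE dvdp_mul // IH // => k km.
by apply/eqP; have /eqP := q0 k.+1 km; rewrite qE mulrC XmS mulrn_eq0.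
Qed.

(** This is the minimal polynomial of M. *)
Definition spectral_modulus N (M : 'M[C]_N) : {poly C} :=
  \prod_(lam <- spectrum M) ('X - lam%:P) ^+ max_jordan_size M lam.

Lemma size_spectral_modulus N (M : 'M[C]_N) :
  size (spectral_modulus M)
    = (\sum_(lam <- spectrum M) max_jordan_size M lam).+1.
Proof.
rewrite /spectral_modulus; elim: (spectrum M) => [|a r IH].
  by rewrite !big_nil size_poly1.
rewrite !big_cons size_Mmonic ?IH ?size_exp_XsubC ?addSn ?addnS //.
  by rewrite -size_poly_gt0 size_exp_XsubC.
by apply: monic_prod => b _; rewrite monic_exp ?monicXsubC.
Qed.

Lemma dvdp_spectral_modulus N (M : 'M[C]_N) lam : lam \in spectrum M ->
  ('X - lam%:P) ^+ max_jordan_size M lam %| spectral_modulus M.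
Proof.
by move=> lamM; rewrite /spectral_modulus (big_rem lam) //= dvdp_mulr.
Qed.

Lemma mxhorner_eq0_derivn N (M : 'M[C]_N) q :
  (forall lam, lam \in spectrum M ->
     forall k, (k < max_jordan_size M lam)%N -> q^`(k).[lam] = 0) ->
  mxhorner q M = 0.
Proof.
move=> q0; apply: (mxhorner_jordan_eq0 (jordan_formP M)) => b bM.
apply/dvdp_exp_XsubCP => k kb; apply: q0; last first.
  exact: leq_trans kb (leq_max_jordan_size bM).
by rewrite mem_spectrum (jordan_form_eigenvalue (jordan_formP M)).
Qed.

(** The degree bound on Hermite interpolants is met by reducing q modulo
    spectral_modulus M, which changes none of the prescribed derivatives; the
    interpolant that defines f(M) then has the same data as q, hence the same
    value at M. *)
Lemma matfun_interpolation N (M : 'M[C]_N) (f : C -> C) q :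
  (forall lam, lam \in spectrum M ->
     forall k, (k < max_jordan_size M lam)%N ->
       q^`(k).[lam] = derive1n k f lam) ->
  matfun f M = mxhorner q M.
Proof.
move=> qf; pose mu := spectral_modulus M.
have mu0 : mu != 0 by rewrite -size_poly_gt0 size_spectral_modulus.
have int_mod : is_hermite_interpolant f M (q %% mu).
  split; first by rewrite -ltnS -size_spectral_modulus ltn_modp.
  move=> lam lamM k km; rewrite -qf // {2}(divp_eq q mu) derivnD hornerD.
  have dv_mu := dvdp_mull (q %/ mu) (dvdp_spectral_modulus lamM).
  have /dvdp_exp_XsubCP -> // := dv_mu.
  by rewrite add0r.
have [_ int_f] : is_hermite_interpolant f M (hermite_interpolant f M).
  exact: (xgetPex 0 (ex_intro _ _ int_mod)).
apply/eqP; rewrite -subr_eq0 -mxhornerN -mxhornerD; apply/eqP.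
apply: mxhorner_eq0_derivn => lam lamM k km.
by rewrite derivnB hornerD hornerN int_f // qf // subrr.
Qed.

End HermiteInterpolation.

(** * Complex derivatives of polynomials and of the inverse *)

Section ComplexDerivatives.
Variable C : numClosedFieldType.

Lemma is_derive_horner (q : {poly C}) (z : C) :
  is_derive z 1 (fun w => q.[w]) q^`().[z].
Proof.
elim/poly_ind: q => [|q c IH].
  have -> : (fun w : C => (0 : {poly C}).[w]) = cst 0.
    by apply/funext => w; rewrite horner0.
  by rewrite deriv0 horner0; exact: is_derive_cst.
have -> : (fun w : C => (q * 'X + c%:P).[w]) = (fun w => q.[w]) * id + cst c.
  by apply/funext => w; rewrite hornerMXaddC.
rewrite derivMXaddC.
have dqX := is_deriveM IH (is_derive_id z (1 : C)).
apply: is_derive_eq (is_deriveD dqX (is_derive_cst c z (1 : C))) _.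
by rewrite addr0 !hornerE /GRing.scale /= mulr1 [z * _]mulrC.
Qed.

Lemma derive1n_horner (q : {poly C}) k :
  derive1n k (fun w => q.[w]) = fun w => q^`(k).[w].
Proof.
elim: k => [|k IH]; first by rewrite derive1n0 derivn0.
rewrite derive1nS IH; apply/funext => z; rewrite derive1E derivnS.
by have [_ ->] := is_derive_horner q^`(k) z.
Qed.

(** The derivative of order k of 1/z is inv_derivn_coef k / z^(k+1). *)
Definition inv_derivn_coef k : C := (-1) ^+ k * (k`!)%:R.

Lemma inv_derivn_coefS k :
  inv_derivn_coef k.+1 = - (k.+1%:R * inv_derivn_coef k).
Proof. by rewrite /inv_derivn_coef exprS factS natrM; ring. Qed.

Lemma near_neq0 (z : C) : z != 0 -> \forall w \near z, w != 0.
Proof. by move=> z0; apply: (cvgr_neq0 (F := nbhs z) (f := id) z). Qed.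

Lemma is_derive_Mexprn_inv (c z : C) k : z != 0 ->
  is_derive z 1 (fun w : C => c * w ^- k.+1) (- (k.+1%:R * c) * z ^- k.+2).
Proof.
move=> z0.
have dX : is_derive z (1 : C) (fun w : C => w ^+ k.+1) (k.+1%:R * z ^+ k).
  have -> : (fun w : C => w ^+ k.+1) = (id : C -> C) ^+ k.+1.
    by apply/funext => w; rewrite fctE.
  by apply: is_derive_eq; rewrite /GRing.scale /= mulr1.
have zk : z ^+ k.+1 != 0 by rewrite expf_neq0.
have dV : is_derive z (1 : C) (fun w : C => w ^- k.+1)
    (- (z ^+ k.+1) ^- 2 *: (k.+1%:R * z ^+ k)).
  have [dX1 dX2] := dX.
  by apply: DeriveDef; [exact: derivableV | rewrite deriveV // dX2].
have -> : (fun w : C => c * w ^- k.+1) = c *: (fun w : C => w ^- k.+1).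
  by apply/funext => w.
apply: is_derive_eq; rewrite /GRing.scale /= !exprS; field.
by rewrite z0 expf_neq0.
Qed.

(** The closed form holds away from 0, which is enough to differentiate it at
    z, since a neighbourhood of z avoids 0. *)
Lemma derive1n_inv k (z : C) : z != 0 ->
  derive1n k (fun w : C => w^-1) z = inv_derivn_coef k * z ^- k.+1.
Proof.
elim: k z => [|k IH] z z0.
  by rewrite derive1n0 /inv_derivn_coef expr0 !mul1r.
rewrite derive1nS derive1E.
rewrite (@near_eq_derive _ C C _ (fun w : C => inv_derivn_coef k * w ^- k.+1)).
  have [_ ->] := is_derive_Mexprn_inv (inv_derivn_coef k) k z0.
  by rewrite inv_derivn_coefS.
by near=> w; apply: IH; near: w; exact: near_neq0.
Unshelve. all: by end_near. Qed.

Lemma has_derivative_inv k (z : C) : z != 0 ->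
  has_derivative [set w | w != 0] (fun w : C => w^-1) k z.
Proof.
elim: k z => //= k IH z z0; split.
  by near=> w; apply: IH; near: w; exact: near_neq0.
have [d _] := is_derive_Mexprn_inv (inv_derivn_coef k) k z0.
apply: near_eq_derivable d; near=> w; rewrite derive1n_inv //.
by near: w; exact: near_neq0.
Unshelve. all: by end_near. Qed.

End ComplexDerivatives.

(** * Matrix functions: polynomials and the inverse *)

Section MatrixInverse.
Variable C : numClosedFieldType.

Lemma unitmx_spectrum N (M : 'M[C]_N) : (M \in unitmx) = (0 \notin spectrum M).
Proof.
rewrite mem_spectrum -row_free_unit -kermx_eq0 /eigenvalue /eigenspace.
by rewrite raddf0 subr0 negbK.
Qed.

Lemma matfun_horner N (M : 'M[C]_N) (q : {poly C}) :
  matfun (fun z => q.[z]) M = mxhorner q M.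
Proof.
by apply: matfun_interpolation => lam _ k _; rewrite derive1n_horner.
Qed.

(** Differentiating X q = 1 modulo (X - lam)^m gives
    lam q^(k+1)(lam) + (k+1) q^(k)(lam) = 0, the recurrence that determines the
    derivatives of 1/z at lam. *)
Lemma derivn_inverse_mod (q : {poly C}) lam m k : lam != 0 ->
  ('X - lam%:P) ^+ m %| 'X * q - 1 -> (k < m)%N ->
  q^`(k).[lam] = inv_derivn_coef C k * lam ^- k.+1.
Proof.
move=> lam0 /dvdp_exp_XsubCP dX.
elim: k => [|k IH] km.
  have := dX _ km; rewrite derivn0 hornerD hornerM hornerX hornerN hornerC.
  move=> /eqP; rewrite subr_eq0 => /eqP lamq.
  rewrite derivn0 /inv_derivn_coef expr0 !mul1r expr1; apply: (mulfI lam0).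
  by rewrite lamq mulfV.
have := dX _ km; rewrite -[X in X * q]subr0 -polyC0 derivnB derivn_XsubC_mul.
rewrite polyC0 subr0 -polyC1 derivnC subr0 hornerD hornerM hornerX hornerMn.
rewrite IH ?(ltnW km) // inv_derivn_coefS => /eqP; rewrite addr_eq0 => /eqP e.
apply: (mulfI lam0); rewrite e -mulr_natl [lam ^+ k.+2]exprS; field.
by rewrite lam0 expf_neq0.
Qed.

(** The inverse q of X modulo spectral_modulus M exists because 0 is not an
    eigenvalue.  Keeping q visible shows that the inverse is a polynomial in M,
    which is what allows it to be carried back to tensors. *)
Lemma matfun_inv N (M : 'M[C]_N) : M \in unitmx ->
  exists2 q : {poly C},
    matfun (fun z : C => z^-1) M = mxhorner q M & M *m mxhorner q M = 1%:M.
Proof.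
rewrite unitmx_spectrum => M0.
have /Bezout_eq1_coprimepP[[u q] /= uq] : coprimep (spectral_modulus M) 'X.
  rewrite coprimepX /root horner_prod prodf_seq_neq0; apply/allP => lam lamM /=.
  rewrite horner_exp expf_neq0 // hornerXsubC sub0r oppr_eq0.
  by apply: contraNneq M0 => <-.
have Xq : 'X * q - 1 = - u * spectral_modulus M by rewrite -uq; ring.
exists q.
  apply: matfun_interpolation => lam lamM k km.
  have lam0 : lam != 0 by apply: contraNneq M0 => <-.
  rewrite derive1n_inv //; apply: derivn_inverse_mod km => //.
  by rewrite Xq dvdp_mull // dvdp_spectral_modulus.
apply/eqP; rewrite -subr_eq0 -{1}(mxhornerX M) -mxhornerM -(mxhornerC 1 M).
rewrite -mxhornerN -mxhornerD polyC1; apply/eqP.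
apply: mxhorner_eq0_derivn => lam lamM; apply/dvdp_exp_XsubCP.
by rewrite Xq dvdp_mull // dvdp_spectral_modulus.
Qed.

End MatrixInverse.

(** * The block circulant morphism *)

Section BlockCirculant.
Variable C : numClosedFieldType.

Lemma bcirc_sum m n p (I : finType) (F : I -> tensor C m n p.+1) :
  bcirc (\sum_i F i) = \sum_i bcirc (F i).
Proof.
rewrite -mxblock_sum; apply: eq_mxblock => i j.
by rewrite sum_ffunE.
Qed.

Lemma bcircZ m n p (c : C) (A : tensor C m n p.+1) :
  bcirc (c *: A) = c *: bcirc A.
Proof. by apply/matrixP => i j; rewrite !mxE ffunE mxE. Qed.

Lemma bcirc_tid n p : bcirc (tid C n p) = 1%:M.
Proof.
rewrite -mxdiagZ; apply: eq_mxblock => i j; rewrite ffunE subr_eq0.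
by case: eqP => // _; rewrite conform_mx_id.
Qed.

(** The block (i, k) of the product is a sum over j of A (i - j) B (j - k),
    which depends on i - k only, by translation of j. *)
Lemma bcirc_tprod m n s p (A : tensor C m n p.+1) (B : tensor C n s p.+1) :
  bcirc (tprod A B) = bcirc A *m bcirc B.
Proof.
rewrite mul_mxblock; apply: eq_mxblock => i k.
rewrite ffunE mul_mxblock_mxrow mxcolK (reindex_inj (addIr (- k))) /=.
by apply: eq_bigr => j _; rewrite opprB addrA subrK.
Qed.

Lemma tprodA1 n p (A : tensor C n n p.+1) : tprod A (tid C n p) = A.
Proof.
apply/ffunP => k; rewrite ffunE mul_mxblock_mxrow mxcolK (bigD1 0) //=.
rewrite ffunE eqxx mulmx1 subr0 big1 ?addr0 // => j /negbTE j0.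
by rewrite ffunE j0 mulmx0.
Qed.

Lemma bcirc_tpow n p (A : tensor C n n p.+1) j :
  bcirc (tpow A j) = bcirc A ^+ j.
Proof.
case: j => [|j]; first by rewrite expr0 bcirc_tid.
elim: j => [|j IH]; first by rewrite expr1.
by rewrite exprS -IH -[RHS]bcirc_tprod.
Qed.

Lemma bcirc_tpoly n p (q : {poly C}) (A : tensor C n n p.+1) :
  bcirc (tpoly q A) = mxhorner q (bcirc A).
Proof.
by rewrite bcirc_sum; apply: eq_bigr => j _; rewrite bcircZ bcirc_tpow.
Qed.

(** The inverse of bcirc A is a polynomial in bcirc A, hence again block
    circulant, and is thus recovered from its first block column. *)
Lemma bcirc_tfun_inv n p (A : tensor C n n p.+1) : bcirc A \in unitmx ->
  bcirc (tfun (fun z => z^-1) A) = matfun (fun z : C => z^-1) (bcirc A).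
Proof.
move=> /matfun_inv[q qE _]; rewrite /tfun qE -bcirc_tpoly.
by rewrite -/(tprod _ _) tprodA1.
Qed.

End BlockCirculant.

(** * Tensors with a single slice *)

Section SingleSlice.
Variable C : numClosedFieldType.

(** The dimension of bcirc A is n only up to a propositional equality.
    Transport along it preserves the Jordan form and the interpolant that were
    chosen, since the choice operators commute with it. *)
Lemma matfun_castmx (f : C -> C) N N' (e : N = N') (M : 'M[C]_N) :
  matfun f (castmx (e, e) M) = castmx (e, e) (matfun f M).
Proof. by case: N' / e; rewrite !castmx_id. Qed.

Lemma bcirc1 n (A : tensor C n n 1) (e : n = (\sum_(k < 1) n)%N) :
  bcirc A = castmx (e, e) (A 0).
Proof.
rewrite (mxEmxblock (A 0)) castmx_comp /= castmx_id; apply: eq_mxblock => i j.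
by rewrite [i - j]ord1.
Qed.

Lemma unfold1 n s (B : tensor C n s 1) (e : n = (\sum_(k < 1) n)%N) :
  unfold B = castmx (e, erefl) (B 0).
Proof.
rewrite (mxEmxcol (B 0)) castmx_comp /= castmx_id; apply: eq_mxcol => i.
by rewrite !ord1.
Qed.

Lemma fold1 n s (X : 'M[C]_(n, s)) (e : n = (\sum_(k < 1) n)%N) :
  fold (castmx (e, erefl) X) = [ffun=> X].
Proof.
apply: (can_inj (@unfoldK _ _ _ _)); rewrite foldK (unfold1 _ e).
by rewrite ffunE.
Qed.

Lemma castmx_mulmx N N' s (e : N = N') (M : 'M[C]_N) (B : 'M_(N, s)) :
  castmx (e, e) M *m castmx (e, erefl) B = castmx (e, erefl) (M *m B).
Proof. by case: N' / e; rewrite !castmx_id. Qed.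

Lemma tfun_act1 (f : C -> C) n s (A : tensor C n n 1) (B : tensor C n s 1) :
  tfun_act f A B = [ffun=> matfun f (A 0) *m B 0].
Proof.
have e : n = (\sum_(k < 1) n)%N by rewrite big_ord1.
rewrite /tfun_act (bcirc1 A e) (unfold1 B e) matfun_castmx castmx_mulmx.
exact: fold1.
Qed.

End SingleSlice.

(** * Tensor t-functions *)

Theorem theorem2p6 (R : realType) (n s p : nat)
    (A : tensor R[i] n n p.+1) (B : tensor R[i] n s p.+1) :
  [/\ (* (i) *)
      forall q : {poly R[i]},
        tfun_act (fun z => q.[z]) A B
          = fold (mxhorner q (bcirc A) *m unfold B) /\
        fold (mxhorner q (bcirc A) *m unfold B)
          = fold (bcirc (tpoly q A) *m unfold B),
      (* (ii) *)
      forall (D : set R[i]) (f : R[i] -> R[i]) (q : {poly R[i]}),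
        defined_on_spectrum D f (bcirc A) ->
        is_hermite_interpolant f (bcirc A) q ->
        matfun f (bcirc A) = mxhorner q (bcirc A) /\
        tfun_act f A B = tprod (tpoly q A) B,
      (* (iii) *)
      p.+1 = 1%N ->
      forall (D : set R[i]) (f : R[i] -> R[i]),
        defined_on_spectrum D f (A 0) ->
        tfun_act f A B = [ffun=> matfun f (A 0) *m B 0] &
      (* (iv) *)
      let inv : R[i] -> R[i] := fun z => z^-1 in
      (bcirc A \in unitmx <->
         defined_on_spectrum [set z | z != 0] inv (bcirc A)) /\
      (bcirc A \in unitmx ->
       [/\ tfun_act inv A A = tid R[i] n p,
           tprod (tfun inv A) A = tid R[i] n p &
           tprod A (tfun inv A) = tid R[i] n p])].
Proof.
split.
- by move=> q; rewrite /tfun_act matfun_horner bcirc_tpoly.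
- move=> D f q _ [_ qf]; have fq := matfun_interpolation qf.
  by rewrite /tfun_act /tprod bcirc_tpoly fq.
- by case: p A B => // A B _ D f _; exact: tfun_act1.
- move=> inv; split; first split.
  + rewrite unitmx_spectrum => A0 lam lamA k _; apply: has_derivative_inv.
    by apply: contraNneq A0 => <-.
  + move=> inv_def; rewrite unitmx_spectrum; apply/negP => A0.
    by have := inv_def 0 A0 0%N (max_jordan_size_gt0 A0); rewrite /= eqxx.
  + move=> Au; have [q fq Mq] := matfun_inv Au.
    have qM := mulmx1C Mq.
    have unfoldA : unfold A = bcirc A *m unfold (tid R[i] n p).
      by rewrite -{1}(tprodA1 A) foldK.
    split.
    * by rewrite /tfun_act fq unfoldA mulmxA qM mul1mx unfoldK.
    * by rewrite /tprod bcirc_tfun_inv // fq unfoldA mulmxA qM mul1mx unfoldK.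
    * by rewrite /tprod /tfun foldK fq mulmxA Mq mul1mx unfoldK.
Qed.
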